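(* Let $\lambda\in\mathbb{C}$ be a complex Pisot number of degree $d$, let $m\ge 1$, and let $s_0,\dots,s_{m-1},v_0,\dots,v_{m-1}\in\mathbb{Z}(\lambda)$, where the rotations $s_k$ are rational, i.e. for each $k$ there is a positive integer $n$ with $s_k^n=1$. Put $g(z)=\lambda z$, $h_k(z)=s_kz+v_k$ and $f_k=g^{-1}h_k$, that is, $f_k(z)=\lambda^{-1}(s_kz+v_k)$, for $k=0,\dots,m-1$. Then the iterated function system $F=\{f_0,\dots,f_{m-1}\}$ on $\mathbb{C}$ is of finite type, i.e. it has only finitely many proper neighbor maps.
   Context: A complex Pisot number is a non-real algebraic integer $\lambda$ with $|\lambda|>1$ such that all roots of its minimal polynomial over $\mathbb{Q}$ other than $\lambda$ and $\overline{\lambda}$ have modulus smaller than $1$. For an algebraic integer $\lambda$ of degree $d$ (the degree of its monic integer minimal polynomial), $\mathbb{Z}(\lambda)=\{\sum_{k=0}^{d-1}n_k\lambda^k \mid n_k\in\mathbb{Z}\}$. An iterated function system (IFS) $F$ is a finite set of contractive similarity maps; here all maps in $F$ have the same contraction factor $r=1/|\lambda|$. The attractor of $F$ is the unique nonempty compact set $A$ with $A=\bigcup_{f\in F}f(A)$; equivalently here $g(A)=\bigcup_{k}h_k(A)$. Let $F^n=\{f_{i_1}f_{i_2}\cdots f_{i_n}\mid f_{i_j}\in F\}$ be the set of compositions of $n$ maps of $F$, and $F^*=\bigcup_{n\ge1}F^n$. A neighbor map is a map of the form $h=f^{-1}g$ with $f,g\in F^*$ (here $g$ denotes an arbitrary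 element of $F^*$). A neighbor map $h$ is proper if $h$ is an isometry (equivalently, since all maps in $F$ have factor $r$, $h=f^{-1}g$ with $f,g\in F^n$ for the same $n$) and $A\cap h(A)\neq\emptyset$. $F$ is of finite type if there are finitely many proper neighbor maps (as maps). *)

(* Defs.v *)
From mathcomp Require Export all_boot all_order all_algebra.
From mathcomp Require Export complex.
From mathcomp Require Export all_classical all_reals all_analysis.
Export numFieldNormedType.Exports.

Set Implicit Arguments.
Unset Strict Implicit.
Unset Printing Implicit Defensive.

Import Order.TTheory GRing.Theory Num.Theory.
Local Open Scope classical_set_scope.
Local Open Scope ring_scope.

Definition algebraic_integer (R : realType) (x : R[i]) : Prop :=
  integralOver (intr : int -> R[i]) x.

Definition is_minimal_polynomial (R : realType) (x : R[i]) (p : {poly rat}) :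
    Prop :=
  [/\ p \is monic, root (map_poly ratr p) x &
      forall q : {poly rat}, q \is monic -> root (map_poly ratr q) x ->
        (size p <= size q)%N].

(* By Gauss's lemma, the minimal polynomial over Q of an algebraic integer has
   integer coefficients, so this is also the degree of its monic integer
   minimal polynomial. *)
Definition has_degree (R : realType) (x : R[i]) (d : nat) : Prop :=
  exists2 p : {poly rat}, is_minimal_polynomial x p & size p = d.+1.

(* The order of R[i] compares only complex numbers with the same imaginary
   part; on moduli, which are real, it is the usual order. *)
Definition complex_pisot (R : realType) (lambda : R[i]) : Prop :=
  [/\ complex.Im lambda != 0,
      algebraic_integer lambda,
      1 < `|lambda| &
      forall p : {poly rat}, is_minimal_polynomial lambda p ->
        forall mu : R[i], root (map_poly ratr p) mu ->
          mu != lambda -> mu != conjc lambda -> `|mu| < 1].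

Definition Zspan (R : realType) (lambda : R[i]) (d : nat) : set R[i] :=
  [set z | exists n : 'I_d -> int, z = \sum_(k < d) (n k)%:~R * lambda ^+ k].

(* The alias R[i]^o carries the topology given by the modulus. *)
Definition is_attractor (R : realType) (F : set (R[i] -> R[i]))
    (A : set R[i]^o) : Prop :=
  [/\ A !=set0, compact A & A = \bigcup_(f in F) (f @` A)].

Fixpoint compositions (T : Type) (F : set (T -> T)) (n : nat) : set (T -> T) :=
  if n is n'.+1 then [set f \o g | f in F & g in compositions F n']
  else [set idfun].

Definition all_compositions (T : Type) (F : set (T -> T)) : set (T -> T) :=
  \bigcup_(n in [set n | (1 <= n)%N]) compositions F n.

Definition neighbor_map (T : Type) (F : set (T -> T)) : set (T -> T) :=
  [set h | exists f finv g : T -> T,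
    [/\ all_compositions F f, all_compositions F g,
        cancel f finv, cancel finv f & h = finv \o g]].

Definition isometry_map (R : realType) (h : R[i] -> R[i]) : Prop :=
  forall x y : R[i], `|h x - h y| = `|x - y|.

Definition proper_neighbor_map (R : realType) (F : set (R[i] -> R[i]))
    (A : set R[i]) : set (R[i] -> R[i]) :=
  [set h | [/\ neighbor_map F h, isometry_map h & A `&` (h @` A) !=set0]].

(* A nonempty finite set F of contractive similarities has exactly one
   attractor A (Hutchinson), so quantifying
   over A only names it. *)
Definition finite_type (R : realType) (F : set (R[i] -> R[i])) : Prop :=
  forall A : set R[i]^o, is_attractor F A ->
    finite_set (proper_neighbor_map F A).

Definition ifs_map (R : realType) (lambda s v : R[i]) : R[i] -> R[i] :=
  fun z => lambda^-1 * (s * z + v).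

Definition ifs (R : realType) (lambda : R[i]) (m : nat) (s v : 'I_m -> R[i]) :
    set (R[i] -> R[i]) :=
  [set ifs_map lambda (s k) (v k) | k in [set: 'I_m]].

(* Main.v *)
(* A composition of n maps has the form z |-> lambda^-n (s z + w) with s, w in
   Z[lambda] and s a product of roots of unity, so a proper neighbor map is
   z |-> t z + u with t, u in Z[lambda], and it suffices to bound all the
   conjugates of t and u.  Those of t have modulus 1.  At a conjugate mu of
   modulus < 1, w is bounded by a geometric series in |mu|, hence so is u; at
   lambda and its complex conjugate, |u| is bounded because A meets h(A) and A
   is bounded.  Finally, an integer polynomial of degree less than that of
   lambda is determined by its values at the distinct conjugates through an
   invertible Vandermonde matrix, so bounded values leave only finitely many
   coefficient vectors. *)
Require Import Defs.
From mathcomp Require Import separable polyorder zify ring.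

Set Implicit Arguments.
Unset Strict Implicit.
Unset Printing Implicit Defensive.

Import Order.TTheory GRing.Theory Num.Theory.
Local Open Scope classical_set_scope.
Local Open Scope ring_scope.

Local Notation ev q z := (map_poly intr q).[z].

(** * Minimal polynomials of algebraic integers *)

Lemma minimal_polynomial_dvd (R : realType) (x : R[i]) (p q : {poly rat}) :
  is_minimal_polynomial x p -> root (map_poly ratr q) x -> p %| q.
Proof.
move=> [pm px pmin] qx; rewrite /dvdp; apply/negPn/negP => r0.
have rx : root (map_poly ratr (q %% p)) x.
  move: qx; rewrite {1}(divp_eq q p) rmorphD rmorphM /= /root hornerD hornerM.
  by rewrite (rootP px) mulr0 add0r.
have lr0 : lead_coef (q %% p) != 0 by rewrite lead_coef_eq0.
(* Made monic, a nonzero remainder would be an annihilator of [x] smaller than [p]. *)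
have /pmin : (lead_coef (q %% p))^-1 *: (q %% p) \is monic.
  by rewrite monicE lead_coefZ mulVf.
rewrite size_scale ?invr_eq0// leqNgt ltn_modp monic_neq0// => h.
apply: (elimF idP _ (h _)) => //.
by rewrite map_polyZ rootZ// fmorph_eq0 invr_eq0.
Qed.

(** An irreducible polynomial is coprime to its derivative, which is nonzero of smaller size in
    characteristic 0. This makes the conjugates pairwise distinct, as the Vandermonde matrix
    requires. *)
Lemma minimal_polynomial_separable (R : realType) (x : R[i]) (p : {poly rat}) :
  is_minimal_polynomial x p -> separable_poly p.
Proof.
move=> hp; have [pm px _] := hp; have p0 := monic_neq0 pm.
have sp : (1 < size p)%N.
  rewrite ltnNge; apply/negP => /size1_polyC pE.
  move: px p0; rewrite pE map_polyC rootC fmorph_eq0 => /eqP ->.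
  by rewrite eqxx.
have irr : irreducible_poly p.
  split=> // q sq1 qp; rewrite /eqp qp /=.
  move: qp; rewrite dvdp_eq => /eqP pE.
  have := px; rewrite pE rmorphM rootM => /orP[] hx; last first.
    by rewrite -pE (minimal_polynomial_dvd hp).
  move: p0; rewrite pE mulf_eq0 negb_or => /andP[c0 q0].
  have := dvdp_leq c0 (minimal_polynomial_dvd hp hx).
  rewrite {1}pE size_mul//; case: (size q) (size_poly_eq0 q) sq1 => [|[|n]] //=.
    by rewrite (negbTE q0).
  by rewrite !addnS /= ltnNge leq_addr.
rewrite unlock irreducible_poly_coprime//; apply/negP => /dvdp_leq.
rewrite -size_poly_eq0 polyorder.size_deriv.
by case: (size p) sp => [|[|n]]//= _ /(_ isT); rewrite ltnn.
Qed.

Lemma map_ratr_intr (R : realType) (q : {poly int}) :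
  map_poly ratr (map_poly intr q) = map_poly intr q :> {poly R[i]}.
Proof.
by rewrite -map_poly_comp (eq_map_poly (g := intr)) //= => z; exact: ratr_int.
Qed.

(** By Gauss's lemma, [p] is a rational multiple of an integer factor [p1] of a monic [q = p1 * r].
    The leading coefficients of [p1] and [r] multiply to 1, so [p1] can be made monic over the
    integers. *)
Lemma minimal_polynomial_int (R : realType) (x : R[i]) (p : {poly rat}) :
  is_minimal_polynomial x p -> algebraic_integer x ->
  exists2 q : {poly int}, q \is monic & p = map_poly intr q.
Proof.
move=> hp [q qm qx]; have [pm _ _] := hp.
have : p %| map_poly intr q.
  by apply: (minimal_polynomial_dvd hp); rewrite map_ratr_intr.
move=> /dvdpP_rat_int [p1 [a a0 pE] [r qE]].
have h1 : lead_coef p1 * lead_coef r = 1 by rewrite -lead_coefM -qE (monicP qm).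
have u0 : lead_coef r != 0.
  by apply/negP => /eqP h; move: h1; rewrite h mulr0.
exists (lead_coef r *: p1); first by rewrite monicE lead_coefZ mulrC h1.
rewrite pE map_polyZ; congr (_ *: _).
have h2 : (lead_coef p1)%:~R * (lead_coef r)%:~R = 1 :> rat.
  by rewrite -intrM h1.
have := monicP pm.
rewrite pE lead_coefZ lead_coef_map_inj ?rmorph0//; last exact: intr_inj.
by move=> h3; rewrite -[LHS]mulr1 -h2 mulrA h3 mul1r.
Qed.

(** * Bounded sets and integer polynomials with bounded values *)

Lemma complex_nat_bound (R : realType) (x : R[i]) :
  exists N : nat, `|x| <= N%:R.
Proof.
exists (Num.Def.archi_bound (complex.Re `|x|)).
rewrite {1}normc_def -(rmorph_nat (real_complex R)) lecR.
set y := Num.sqrt _; have -> : complex.Re `|x| = y by rewrite normc_def.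
by apply/ltW/archi_boundP/sqrtr_ge0.
Qed.

Lemma compact_complex_bounded (R : realType) (A : set R[i]^o) :
  compact A -> exists M : R[i], forall z, A z -> `|z : R[i]| <= M.
Proof.
move=> /compact_near_coveringP.
move=> /(_ nat \oo (fun N (z : R[i]^o) => `|z : R[i]| <= N%:R) _).
case.
  move=> z Az; have [N hN] := complex_nat_bound z.
  (* On the unit ball around [z], a bound greater than [N] absorbs the radius; compactness then
     yields one bound for all of [A]. *)
  exists ([set y | `|(z : R[i]^o) - y| < 1], [set n | (N < n)%N]).
    split; last by exists N.+1.
    exact: (@nbhsx_ballx _ (R[i]^o) z 1).
  case=> y n [/= yz Nn].
  have -> : y = z - (z - y) :> R[i] by rewrite opprB addrC subrK.
  rewrite (le_trans (ler_normB _ _))//.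
  rewrite (@le_trans _ _ (N%:R + 1))//; first by rewrite lerD// ltW.
  by rewrite natr1 ler_nat.
move=> N _ h; exists N%:R => z Az; by apply: (h N) => //=.
Qed.

Lemma finite_int_poly_bounded_values (R : realType) (rs : seq R[i])
    (C : R[i] -> R[i]) :
  uniq rs ->
  finite_set [set q : {poly int} | (size q <= size rs)%N /\
    forall mu, mu \in rs -> `|(map_poly intr q).[mu]| <= C mu].
Proof.
move=> urs; set d := size rs.
pose a : 'rV[R[i]]_d := \row_j rs`_j.
pose V := Vandermonde d a.
have Vu : V \in unitmx.
  rewrite unitmxE unitfE det_Vandermonde; apply/prodf_neq0 => i _.
  apply/prodf_neq0 => j ij; rewrite !mxE subr_eq0 nth_uniq//.
  by rewrite gtn_eqF.
(* Summing over all entries of the inverse matrix gives one constant that serves every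
   coefficient. *)
pose D : R[i] := \sum_(k < d) \sum_(j < d) C rs`_j * `|invmx V j k|.
have [N hN] := complex_nat_bound D.
(* Integers from [-N] to [N] are encoded as ordinals below [2N+1], shifted by [N]. *)
pose f (r : 'rV['I_(N.*2.+1)]_d) : {poly int} :=
  rVpoly (map_mx (fun i : 'I__ => (i : nat)%:Z - N%:Z) r).
apply: (@sub_finite_set _ _ (f @` setT)); last exact/finite_image/finite_finset.
(* Nonnegativity of [C] on [rs] comes from the norms that it bounds. *)
move=> q [sq hq]; have C0 (j : 'I_d) : 0 <= C rs`_j.
  by rewrite (le_trans _ (hq _ (mem_nth _ (ltn_ord j)))).
have qE : map_mx (intr : int -> R[i]) (poly_rV q) =
    (\row_j (map_poly intr q).[rs`_j]) *m invmx V.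
  apply: (canRL (mulmxK Vu)); apply/rowP => j; rewrite !mxE.
  rewrite (@horner_coef_wide _ d); last first.
    by rewrite (leq_trans (size_poly _ _)).
  by apply: eq_bigr => i _; rewrite !mxE coef_map.
have hc (k : 'I_d) : (`|(q`_k)%R| <= N)%N.
  have /rowP/(_ k) := qE; rewrite !mxE => qk.
  rewrite -(ler_nat R[i]) natr_absz intr_norm qk (le_trans _ hN)//.
  have D0 : 0 <= D.
    by apply: sumr_ge0 => i _; apply: sumr_ge0 => j _; rewrite mulr_ge0.
  rewrite (ger0_norm D0) /D [leRHS](bigD1 k)//= ler_wpDr//.
    by apply: sumr_ge0 => i _; apply: sumr_ge0 => j _; rewrite mulr_ge0.
  apply: le_trans (ler_norm_sum _ _ _) _; apply: ler_sum => j _.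
  by rewrite normrM ler_wpM2r// mxE hq// mem_nth.
exists (\row_k inord `|(q`_k + N%:Z)%R|%N) => //.
rewrite /f -[RHS](poly_rV_K sq); congr rVpoly; apply/rowP => k; rewrite !mxE.
have := hc k; move: (q`_k) => c hck.
have c0 : 0 <= c + N%:Z by lia.
rewrite inordK; last by lia.
by rewrite gez0_abs// addrK.
Qed.

(** * Conjugates, read as values of one integer polynomial at all roots of [p] *)

Lemma conjugate_root (R : realType) (x mu : R[i]) (p : {poly rat})
    (q : {poly int}) :
  is_minimal_polynomial x p -> root (map_poly ratr p) mu ->
  ev q x = 0 -> ev q mu = 0.
Proof.
move=> hp pmu qx; apply/rootP; rewrite -map_ratr_intr.
apply: root_dvdp pmu; rewrite dvdp_map; apply: (minimal_polynomial_dvd hp).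
by rewrite map_ratr_intr; exact/rootP.
Qed.

(** Reducing [q] modulo the monic integer polynomial [P] keeps its values at all conjugates and
    brings its size down to their number, where the Vandermonde bound applies. *)
Lemma finite_bounded_conjugates (R : realType) (x : R[i]) (p : {poly rat})
    (C : R[i] -> R[i]) :
  is_minimal_polynomial x p -> algebraic_integer x ->
  finite_set [set ev q x | q in [set q : {poly int} |
    forall mu : R[i], root (map_poly ratr p) mu -> `|ev q mu| <= C mu]].
Proof.
move=> hp xint; have [P Pm pE] := minimal_polynomial_int hp xint.
have [pm px _] := hp.
have [rs rsE] := closed_field_poly_normal (map_poly ratr p : {poly R[i]}).
rewrite lead_coef_map (monicP pm) rmorph1 scale1r in rsE.
have urs : uniq rs.
  rewrite -separable_prod_XsubC -rsE separable_map.
  exact: minimal_polynomial_separable hp.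
have srs : size P = (size rs).+1.
  rewrite -(size_prod_XsubC rs id) -rsE size_map_poly pE.
  by rewrite size_map_inj_poly//; exact: intr_inj.
have := finite_image (fun q : {poly int} => ev q x)
  (finite_int_poly_bounded_values C urs).
apply: sub_finite_set => _ [q hq <-].
have Px : ev P x = 0 by rewrite -map_ratr_intr -pE; exact/rootP.
have evE (mu : R[i]) : root (map_poly ratr p) mu -> ev (q %% P) mu = ev q mu.
  move=> pmu; have Pmu := conjugate_root hp pmu Px.
  rewrite [in RHS](Pdiv.IdomainMonic.divp_eq Pm q) rmorphD rmorphM.
  by rewrite hornerD hornerM Pmu mulr0 add0r.
exists (q %% P); last exact: evE.
split; first by rewrite -ltnS -srs ltn_modp monic_neq0.
move=> mu mus; have pmu : root (map_poly ratr p) mu.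
  by rewrite rsE root_prod_XsubC.
by rewrite evE// hq.
Qed.

(** * Linear parts and translations of compositions *)

Lemma int_poly_conjc (R : realType) (x : R[i]) (q : {poly int}) :
  ev q (conjc x) = conjc (ev q x).
Proof.
rewrite -horner_map -map_poly_comp; congr _.[_].
by apply: eq_map_poly => z; rewrite /= rmorph_int.
Qed.

Lemma Zspan_int_poly (R : realType) (x z : R[i]) (d : nat) :
  Zspan x d z -> exists q : {poly int}, ev q x = z.
Proof.
move=> [n ->]; exists (\sum_(k < d) n k *: 'X^k).
rewrite rmorph_sum horner_sum; apply: eq_bigr => k _ /=.
by rewrite map_polyZ map_polyXn hornerZ hornerXn.
Qed.

(** The inverse of a root of unity is its power [n.-1], hence again an integer polynomial in [x];
    the relation [S ^+ n = 1] passes to every conjugate and forces modulus 1 there. *)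
Lemma conjugate_root_of_unity (R : realType) (x : R[i]) (p : {poly rat})
    (S : {poly int}) (n : nat) :
  is_minimal_polynomial x p -> (0 < n)%N -> ev S x ^+ n = 1 ->
  exists2 T : {poly int}, ev (S * T) x = 1 &
    forall mu : R[i], root (map_poly ratr p) mu ->
      `|ev S mu| <= 1 /\ `|ev T mu| <= 1.
Proof.
move=> hp n0 Sx; exists (S ^+ n.-1).
  by rewrite -exprS prednK// rmorphXn horner_exp.
move=> mu pmu.
have /eqP : ev (S ^+ n - 1) mu = 0.
  apply: (conjugate_root hp) => //.
  rewrite rmorphB rmorph1 rmorphXn /= hornerD hornerN hornerC horner_exp.
  by rewrite Sx subrr.
rewrite rmorphB rmorph1 rmorphXn /= hornerD hornerN hornerC horner_exp subr_eq0.
move=> /eqP/(congr1 Num.norm); rewrite normrX normr1 => /eqP.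
rewrite pexpr_eq1// => /eqP S1.
by rewrite rmorphXn /= horner_exp normrX S1 expr1n lexx.
Qed.

(** [T'] carries the inverse of the linear part. The bound on [W] is a finite geometric sum with its
    denominator cleared, which suits the induction. *)
Lemma composition_int_poly (R : realType) (lambda : R[i]) (m : nat)
    (s v : 'I_m -> R[i]) (S T V : 'I_m -> {poly int}) (E : set R[i]) :
  lambda != 0 ->
  (forall k, ev (S k) lambda = s k) -> (forall k, ev (V k) lambda = v k) ->
  (forall k, ev (S k * T k) lambda = 1) ->
  (forall k mu, E mu -> `|ev (S k) mu| <= 1 /\ `|ev (T k) mu| <= 1) ->
  forall n f, compositions (ifs lambda s v) n f ->
  exists S' T' W : {poly int},
    [/\ forall z, f z = lambda ^- n * (ev S' lambda * z + ev W lambda),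
        ev (S' * T') lambda = 1,
        forall mu, E mu -> `|ev S' mu| <= 1 /\ `|ev T' mu| <= 1 &
        forall mu, E mu -> `|mu| < 1 ->
          `|ev W mu| * (1 - `|mu|) <=
            (\sum_k `|ev (V k) mu|) * (1 - `|mu| ^+ n)].
Proof.
move=> l0 hS hV hST hE; elim=> [|n IHn] f /=.
  move=> ->; exists 1, 1, 0; rewrite mulr1; split => [z||mu _|mu _ _].
  - by rewrite expr0 invr1 mul1r rmorph1 rmorph0 hornerC horner0 mul1r addr0.
  - by rewrite rmorph1 hornerC.
  - by rewrite rmorph1 hornerC normr1.
  - by rewrite rmorph0 horner0 normr0 expr0 subrr mulr0 mul0r.
move=> [_ [k _ <-] [g /IHn[S' [T' [W [gE ST' hE' hW]]]] <-]].
(* Applying [f_k] after [g] multiplies [S'] and [W] by [s_k] and adds [v_k], scaled by [lambda ^+ n]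
   to share the factor [lambda ^- n.+1]. *)
exists (S k * S'), (T' * T k), (S k * W + 'X^n * V k); split.
- move=> z; rewrite /= /ifs_map gE !rmorphM !rmorphD !rmorphM /= map_polyXn.
  rewrite hornerD !hornerM hornerXn hS hV.
  rewrite exprS invfM; field.
  by rewrite l0 expf_neq0.
- have -> : S k * S' * (T' * T k) = S' * T' * (S k * T k) by ring.
  by rewrite rmorphM hornerM ST' hST mulr1.
- move=> mu Emu; have [Sk Tk] := hE k _ Emu; have [S1 T1] := hE' _ Emu.
  by rewrite !rmorphM !hornerM !normrM !mulr_ile1.
- move=> mu Emu mu1; have [Sk _] := hE k _ Emu.
  rewrite rmorphD !rmorphM /= map_polyXn hornerD !hornerM hornerXn.
  have mu1' : 0 <= 1 - `|mu| by rewrite subr_ge0 ltW.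
  apply: (@le_trans _ _ ((`|ev W mu| + `|mu| ^+ n * `|ev (V k) mu|)
    * (1 - `|mu|))).
    rewrite ler_wpM2r// (le_trans (ler_normD _ _))// !normrM normrX lerD2r.
    by rewrite ler_piMl.
  set B := \sum_ _ _.
  have -> : B * (1 - `|mu| ^+ n.+1) =
      B * (1 - `|mu| ^+ n) + `|mu| ^+ n * B * (1 - `|mu|).
    by rewrite exprS; ring.
  rewrite mulrDl lerD ?hW// ler_wpM2r// ler_wpM2l ?exprn_ge0//.
  by rewrite /B (bigD1 k)//= ler_wpDr// sumr_ge0.
Qed.

Theorem theorem3 (R : realType) (lambda : R[i]) (d m : nat)
    (s v : 'I_m -> R[i])
    (hlambda : complex_pisot lambda)
    (hd : has_degree lambda d)
    (hm : (1 <= m)%N)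
    (hs : forall k : 'I_m, Zspan lambda d (s k))
    (hv : forall k : 'I_m, Zspan lambda d (v k))
    (hrot : forall k : 'I_m, exists2 n : nat, (0 < n)%N & s k ^+ n = 1) :
  finite_type (ifs lambda s v).
Proof.
have [_ lint l1 lconj] := hlambda; have [p hp _] := hd.
have {}lconj := lconj p hp; have [_ pl _] := hp.
have l0 : lambda != 0.
  by apply: contraTneq l1 => ->; rewrite normr0 ltr10.
pose E : set R[i] := [set mu | root (map_poly ratr p) mu].
have /choice[V hV] : forall k, exists V : {poly int}, ev V lambda = v k.
  by move=> k; exact: Zspan_int_poly (hv k).
have /choice[S hS] : forall k, exists S : {poly int}, ev S lambda = s k.
  by move=> k; exact: Zspan_int_poly (hs k).
have /choice[T hT] : forall k, exists T : {poly int},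
    ev (S k * T) lambda = 1 /\
    forall mu, E mu -> `|ev (S k) mu| <= 1 /\ `|ev T mu| <= 1.
  move=> k; have [n n0 sn] := hrot k; rewrite -hS in sn.
  by have [T] := conjugate_root_of_unity hp n0 sn; exists T.
have form := composition_int_poly l0 hS hV (fun k => (hT k).1)
  (fun k => (hT k).2).
move=> A [_ Ac _]; have [M hM] := compact_complex_bounded Ac.
(* [B] is the full geometric series. Both bounds in [C] are doubled because [u] is controlled by a
   difference of two terms. *)
pose B mu : R[i] := (\sum_k `|ev (V k) mu|) / (1 - `|mu|).
pose C mu : R[i] := if `|mu| < 1 then B mu *+ 2 else M *+ 2.
have Tfin := finite_bounded_conjugates (fun=> 1) hp lint.
have Ufin := finite_bounded_conjugates C hp lint.
apply: sub_finite_set (finite_image2 (fun t u z => t * z + u) Tfin Ufin).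
move=> h [[f [finv [g [[n _ Ff] [n' _ Fg] fK finvK hE]]]] hiso].
move=> [a [Aa [b Ab hb]]].
have [S1 [T1 [W1 [fE ST1 h1 hW1]]]] := form _ _ Ff.
have [S2 [T2 [W2 [gE ST2 h2 hW2]]]] := form _ _ Fg.
have unit_norm (P Q : {poly int}) : ev (P * Q) lambda = 1 ->
    (forall mu, E mu -> `|ev P mu| <= 1 /\ `|ev Q mu| <= 1) ->
    `|ev P lambda| = 1.
  move=> PQ hPQ; have [P1 Q1] := hPQ _ pl; apply/eqP; rewrite eq_le P1 /=.
  move: PQ; rewrite rmorphM hornerM => /(congr1 Num.norm).
  by rewrite normrM normr1 => PQn; rewrite -[leLHS]PQn ler_piMr.
have S1n := unit_norm _ _ ST1 h1; have S2n := unit_norm _ _ ST2 h2.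
have fhE z : f (h z) = g z by rewrite hE /= finvK.
(* The contraction ratios of [f \o h] and [g] agree and [h] is an isometry, so the powers of
   [|lambda|] agree. *)
have nn' : n = n'.
  have fB x y : f x - f y = lambda ^- n * (ev S1 lambda * (x - y)).
    by rewrite !fE; ring.
  have gB x y : g x - g y = lambda ^- n' * (ev S2 lambda * (x - y)).
    by rewrite !gE; ring.
  have := fB (h 1) (h 0); rewrite !fhE gB => /(congr1 Num.norm).
  rewrite 4!normrM S1n S2n hiso subr0 normr1 !mulr1 !normfV !normrX.
  by move=> /invr_inj/ieexprIn-> //; rewrite ?gt_eqF// (lt_trans ltr01).
(* Solve [S1 * h z + W1 = S2 * z + W2] for [h z], with [T1] as the inverse of [S1]. *)
pose u := T1 * (W2 - W1).
have hform z : h z = ev (T1 * S2) lambda * z + ev u lambda.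
  have := fhE z; rewrite fE gE nn' => /(mulfI (invr_neq0 (expf_neq0 _ l0))) eqz.
  have : ev T1 lambda * (ev S1 lambda * h z + ev W1 lambda) =
    ev T1 lambda * (ev S2 lambda * z + ev W2 lambda) by rewrite eqz.
  move: ST1; rewrite /u !rmorphM rmorphB /= !hornerM hornerD hornerN => ST1.
  rewrite mulrDr mulrA [ev T1 _ * ev S1 _]mulrC ST1 mul1r.
  by move=> /(canRL (addrK _)) ->; ring.
(* Here [a = h b] with both points in [A], so [u] is a difference of two numbers of modulus at most
   [M]. *)
have ulambda : `|ev u lambda| <= M *+ 2.
  have -> : ev u lambda = a - ev (T1 * S2) lambda * b.
    by rewrite -hb hform addrAC subrr add0r.
  rewrite (le_trans (ler_normB _ _))// mulr2n lerD ?(hM a)//.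
  rewrite rmorphM hornerM !normrM S2n mulr1.
  by rewrite (le_trans _ (hM _ Ab))// ler_piMl//; have [] := h1 _ pl.
exists (ev (T1 * S2) lambda).
  exists (T1 * S2) => // mu pmu.
  have [_ T1n] := h1 _ pmu; have [S2n' _] := h2 _ pmu.
  by rewrite rmorphM hornerM normrM mulr_ile1.
exists (ev u lambda); last by apply/funext => z; rewrite hform.
exists u => // mu pmu.
rewrite /C; case: ifPn => mu1.
  have [_ T1n] := h1 _ pmu.
  have bound W k : `|ev W mu| * (1 - `|mu|) <=
      (\sum_k `|ev (V k) mu|) * (1 - `|mu| ^+ k) -> `|ev W mu| <= B mu.
    move=> hW; rewrite /B ler_pdivlMr ?subr_gt0// (le_trans hW)//.
    by rewrite ler_piMr ?sumr_ge0// lerBlDr lerDl exprn_ge0.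
  rewrite /u rmorphM rmorphB hornerM hornerD hornerN normrM.
  rewrite (@le_trans _ _ (`|ev W2 mu - ev W1 mu|)) ?ler_piMl//.
  rewrite (le_trans (ler_normB _ _))// mulr2n lerD//.
    exact: bound (hW2 _ pmu mu1).
  exact: bound (hW1 _ pmu mu1).
(* By the Pisot condition only [lambda] and its complex conjugate remain, where [u] has equal
   moduli. *)
have [->//|mul] := eqVneq mu lambda.
have [->|mucl] := eqVneq mu (conjc lambda).
  by rewrite int_poly_conjc normcJ.
by rewrite lconj in mu1.
Qed.
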